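(* Let $U\subseteq\mathbb H$ be an axially symmetric domain (connected open set) and let $f:U\to\mathbb H$ be a left slice hyperholomorphic function. Let $\breve f=\Delta f$. If $q=u+I_{\underline q}v\in U\setminus\mathbb R$, where $u=q_0$, $v=|\underline q|$, $I_{\underline q}=\underline q/|\underline q|$, then for every $I\in\mathbb S$, setting $q_{\pm I}=u\pm Iv$, $$\breve f(q)=\Delta f(q)=|\underline q|^{-2}I_{\underline q}\Big(2|\underline q|\,\frac{\partial}{\partial u}f(q)-I\big(f(q_{-I})-f(q_I)\big)\Big).$$ If $q=u\in U\cap\mathbb R$, then $$\Delta f(u)=-2\,\frac{\partial^2}{\partial u^2}f(u).$$ Moreover the formulas do not depend on the choice of the Fueter primitive: if $f_1:U\to\mathbb H$ is another left slice hyperholomorphic function with $\Delta f_1=\Delta f$ on $U$, then replacing $f$ by $f_1$ does not change the right-hand sides.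
   Context: $\mathbb H$ denotes the quaternions $q=q_0+q_1e_1+q_2e_2+q_3e_3$ ($q_i\in\mathbb R$, $e_1^2=e_2^2=e_3^2=-1$, $e_1e_2=-e_2e_1=e_3$, $e_2e_3=-e_3e_2=e_1$, $e_3e_1=-e_1e_3=e_2$), $\underline q=q_1e_1+q_2e_2+q_3e_3$, $|q|$ is the Euclidean norm. $\mathbb S=\{\underline q: |\underline q|=1\}$, and $[q]=\{q_0+I|\underline q| : I\in\mathbb S\}$. A set $U\subseteq\mathbb H$ is axially symmetric if $[q]\subset U$ for all $q\in U$. Slice hyperholomorphic functions: let $U$ be an axially symmetric open set and $\mathcal U=\{(u,v)\in\mathbb R^2: u+\mathbb Sv\subset U\}$. A function $f:U\to\mathbb H$ is left slice hyperholomorphic if $f(u+Iv)=\alpha(u,v)+I\beta(u,v)$ for all $(u,v)\in\mathcal U$, $I\in\mathbb S$, with $C^1$ functions $\alpha,\beta:\mathcal U\to\mathbb H$ satisfying $\alpha(u,v)=\alpha(u,-v)$, $\beta(u,v)=-\beta(u,-v)$ and $\partial_u\alpha-\partial_v\beta=0$, $\partial_v\alpha+\partial_u\beta=0$. $\Delta=\partial_{q_0}^2+\partial_{q_1}^2+\partial_{q_2}^2+\partial_{q_3}^2$. $\frac{\partial}{\partial u}f(q)$ is the partial derivative $\partial_{q_0}f(q)$. A Fueter primitive of a function $\breve f$ is a left slice hyperholomorphic $f$ with $\Delta f=\breve f$. *)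

(* Defs.v *)
From Stdlib Require Import Reals.
From Coquelicot Require Import Coquelicot.
Open Scope R_scope.

(** Quaternions [q0 + q1 e1 + q2 e2 + q3 e3], carried by [R * R * R * R] so
    that Coquelicot's product topology and derivatives apply to them. *)
Definition quat : Type := (R * R * R * R)%type.

Declare Scope quat_scope.
Delimit Scope quat_scope with quat.
Bind Scope quat_scope with quat.

Definition mkq (a b c d : R) : quat := (a, b, c, d).
Definition q0 (q : quat) : R := fst (fst (fst q)).
Definition q1 (q : quat) : R := snd (fst (fst q)).
Definition q2 (q : quat) : R := snd (fst q).
Definition q3 (q : quat) : R := snd q.

Definition RtoQ (x : R) : quat := mkq x 0 0 0.
Coercion RtoQ : R >-> quat.

Definition e1 : quat := mkq 0 1 0 0.
Definition e2 : quat := mkq 0 0 1 0.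
Definition e3 : quat := mkq 0 0 0 1.

Definition qadd (p q : quat) : quat :=
  mkq (q0 p + q0 q) (q1 p + q1 q) (q2 p + q2 q) (q3 p + q3 q).
Definition qopp (q : quat) : quat := mkq (- q0 q) (- q1 q) (- q2 q) (- q3 q).
Definition qsub (p q : quat) : quat := qadd p (qopp q).
Definition qmul (p q : quat) : quat :=
  mkq (q0 p * q0 q - q1 p * q1 q - q2 p * q2 q - q3 p * q3 q)
      (q0 p * q1 q + q1 p * q0 q + q2 p * q3 q - q3 p * q2 q)
      (q0 p * q2 q - q1 p * q3 q + q2 p * q0 q + q3 p * q1 q)
      (q0 p * q3 q + q1 p * q2 q - q2 p * q1 q + q3 p * q0 q).

Infix "+" := qadd : quat_scope.
Infix "-" := qsub : quat_scope.
Infix "*" := qmul : quat_scope.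
Notation "- q" := (qopp q) : quat_scope.

Definition qnorm (q : quat) : R :=
  sqrt (q0 q ^ 2 + q1 q ^ 2 + q2 q ^ 2 + q3 q ^ 2).

Definition qvec (q : quat) : quat := mkq 0 (q1 q) (q2 q) (q3 q).

Definition is_real (q : quat) : Prop := qvec q = RtoQ 0.

Definition sphere (I : quat) : Prop := q0 I = 0 /\ qnorm I = 1.

(** [I_q], meaningful only when [q] is not real. *)
Definition Iunit (q : quat) : quat := (RtoQ (/ qnorm (qvec q)) * qvec q)%quat.

(** The 2-sphere [[q]]. *)
Definition qclass (q p : quat) : Prop :=
  exists I, sphere I /\ p = (RtoQ (q0 q) + I * RtoQ (qnorm (qvec q)))%quat.

Definition axially_symmetric (U : quat -> Prop) : Prop :=
  forall q, U q -> forall p, qclass q p -> U p.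

Definition connected (U : quat -> Prop) : Prop :=
  forall A B : quat -> Prop, open A -> open B ->
    (forall q, U q -> A q \/ B q) ->
    (exists q, U q /\ A q) -> (exists q, U q /\ B q) ->
    exists q, U q /\ A q /\ B q.

(** Derivative of a quaternion-valued function of a real variable. It is a
    total function, like [Derive]: its value is meaningful only where
    [ex_derive g t] holds for the product normed module structure. *)
Definition qDerive (g : R -> quat) (t : R) : quat :=
  mkq (Derive (fun s => q0 (g s)) t) (Derive (fun s => q1 (g s)) t)
      (Derive (fun s => q2 (g s)) t) (Derive (fun s => q3 (g s)) t).

(** Partial derivatives on [quat]: directions [RtoQ 1, e1, e2, e3] give the
    derivatives in [q0, q1, q2, q3]. *)
Definition partial (e : quat) (f : quat -> quat) (q : quat) : quat :=
  qDerive (fun t : R => f (q + RtoQ t * e)%quat) 0.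

Definition ex_partial (e : quat) (f : quat -> quat) (q : quat) : Prop :=
  ex_derive (fun t : R => f (q + RtoQ t * e)%quat) 0.

Definition ex_partial2 (e : quat) (f : quat -> quat) (q : quat) : Prop :=
  locally q (ex_partial e f) /\ ex_partial e (partial e f) q.

Definition laplacian (f : quat -> quat) (q : quat) : quat :=
  (partial (RtoQ 1) (partial (RtoQ 1) f) q + partial e1 (partial e1 f) q
   + partial e2 (partial e2 f) q + partial e3 (partial e3 f) q)%quat.

(** [laplacian f q] is a sum of genuine second derivatives. *)
Definition ex_laplacian (f : quat -> quat) (q : quat) : Prop :=
  ex_partial2 (RtoQ 1) f q /\ ex_partial2 e1 f q /\
  ex_partial2 e2 f q /\ ex_partial2 e3 f q.

Definition du (a : R -> R -> quat) (u v : R) : quat :=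
  qDerive (fun x => a x v) u.
Definition dv (a : R -> R -> quat) (u v : R) : quat :=
  qDerive (fun y => a u y) v.

(** [C^1] on a set [D], which is open in the only use made of it below. *)
Definition C1_on (D : R -> R -> Prop) (a : R -> R -> quat) : Prop :=
  forall u v, D u v ->
    ex_derive (fun x => a x v) u /\ ex_derive (fun y => a u y) v /\
    continuous (fun p : R * R => du a (fst p) (snd p)) (u, v) /\
    continuous (fun p : R * R => dv a (fst p) (snd p)) (u, v).

Definition slice_domain (U : quat -> Prop) (u v : R) : Prop :=
  forall I, sphere I -> U (RtoQ u + I * RtoQ v)%quat.

(** Functions on [U] are total functions of which only the values on [U]
    are used; likewise for [alpha], [beta] on [slice_domain U]. *)
Definition slice_hyperholomorphic (U : quat -> Prop) (f : quat -> quat) : Prop :=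
  exists alpha beta : R -> R -> quat,
    C1_on (slice_domain U) alpha /\ C1_on (slice_domain U) beta /\
    forall u v, slice_domain U u v ->
      (forall I, sphere I ->
         f (RtoQ u + I * RtoQ v)%quat = (alpha u v + I * beta u v)%quat) /\
      alpha u v = alpha u (- v)%R /\
      beta u v = (- beta u (- v)%R)%quat /\
      (du alpha u v - dv beta u v)%quat = RtoQ 0 /\
      (dv alpha u v + du beta u v)%quat = RtoQ 0.

(* Main.v *)
(** Write F = alpha + I beta.  Every coordinate of (alpha, beta) is a C^1
    solution of the Cauchy-Riemann equations, and Cauchy's integral formula for
    the derivative on a circle shows that its first partials are again
    differentiable, with alpha and beta harmonic in (u, v).  Off the real axis
    f(q) = alpha(u, v) + w (beta(u, v) / v) with w the vector part of q and
    v = |w|, so the chain rule in v and harmonicity give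
    Delta f = (2/v) dv alpha + I ((2/v) dv beta - (2/v^2) beta).
    At a real point u, parity gives f(u + t e) = alpha(u, t) + e beta(u, t) for
    t of either sign, so each imaginary direction contributes
    dv^2 alpha = - du^2 alpha.  Independence of the primitive follows because
    the right-hand sides equal the Laplacian. *)
Require Import Defs.
From Stdlib Require Import Reals Lra Classical.
From Coquelicot Require Import Coquelicot.
Open Scope R_scope.

(** * Cauchy's formula for Cauchy-Riemann pairs *)

Definition pu (a : R -> R -> R) (u v : R) : R := Derive (fun x => a x v) u.
Definition pv (a : R -> R -> R) (u v : R) : R := Derive (fun y => a u y) v.

Definition open_2d (D : R -> R -> Prop) : Prop :=
  forall u v, D u v -> locally_2d D u v.

Definition C1_2d (D : R -> R -> Prop) (a : R -> R -> R) : Prop :=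
  forall u v, D u v ->
    ex_derive (fun x => a x v) u /\ ex_derive (fun y => a u y) v /\
    continuous (fun p : R * R => pu a (fst p) (snd p)) (u, v) /\
    continuous (fun p : R * R => pv a (fst p) (snd p)) (u, v).

Definition cauchy_riemann (D : R -> R -> Prop) (a b : R -> R -> R) : Prop :=
  forall u v, D u v -> pu a u v = pv b u v /\ pv a u v = - pu b u v.

(** Total differentiability follows from a continuous [u]-partial near the point and a [v]-partial
    at it; openness of [D] supplies the neighbourhood. *)
Lemma C1_2d_differentiable D a u v :
  open_2d D -> C1_2d D a -> D u v ->
  differentiable_pt_lim a u v (pu a u v) (pv a u v).
Proof.
intros HD Ha Huv.
apply filterdiff_differentiable_pt_lim.
apply (is_derive_filterdiff a u v (pu a) (pv a u v)).
- destruct (HD _ _ Huv) as [d Hd]; exists d; intros [x y] [Hx Hy].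
  apply Derive_correct, (Ha x y (Hd x y Hx Hy)).
- apply Derive_correct, (Ha u v Huv).
- apply (Ha u v Huv).
Qed.

Lemma C1_2d_continuous D a u v :
  open_2d D -> C1_2d D a -> D u v ->
  continuous (fun p : R * R => a (fst p) (snd p)) (u, v).
Proof.
intros HD Ha Huv.
apply continuity_2d_pt_filterlim, differentiable_continuity_pt.
exists (pu a u v), (pv a u v); now apply (C1_2d_differentiable D).
Qed.

Lemma C1_2d_chain D a (x y : R -> R) t x' y' :
  open_2d D -> C1_2d D a -> D (x t) (y t) ->
  is_derive x t x' -> is_derive y t y' ->
  is_derive (fun s => a (x s) (y s)) t
    (pu a (x t) (y t) * x' + pv a (x t) (y t) * y').
Proof.
intros HD Ha H Hx Hy.
apply is_derive_Reals, derivable_pt_lim_comp_2d.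
- now apply (C1_2d_differentiable D).
- now apply is_derive_Reals.
- now apply is_derive_Reals.
Qed.

(** * Differentiation under the integral sign and elementary limits *)

Lemma is_derive_RInt_param_C1 (f df : R -> R -> R) (a b x d : R) :
  0 < d ->
  (forall z t, Rabs (z - x) < d -> is_derive (fun s => f s t) z (df z t)) ->
  (forall t, continuous (fun p : R * R => df (fst p) (snd p)) (x, t)) ->
  (forall z t, Rabs (z - x) < d -> continuous (f z) t) ->
  is_derive (fun z => RInt (f z) a b) x (RInt (df x) a b).
Proof.
intros Hd Hf Hdf Hc.
assert (Hx : Rabs (x - x) < d) by (rewrite Rminus_diag, Rabs_R0; exact Hd).
rewrite (RInt_ext (df x) (fun t => Derive (fun u => f u t) x)).
2: intros t _; symmetry; now apply is_derive_unique, Hf.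
apply is_derive_RInt_param.
- exists (mkposreal d Hd); intros z Hz t _; exists (df z t); now apply Hf.
- intros t _; apply continuity_2d_pt_ext_loc with df.
  + exists (mkposreal d Hd); intros u v Hu _; symmetry.
    now apply is_derive_unique, Hf.
  + apply continuity_2d_pt_filterlim, Hdf.
- exists (mkposreal d Hd); intros z Hz.
  apply (ex_RInt_continuous (V := R_CompleteNormedModule)).
  intros t _; now apply Hc.
Qed.

(** Since the derivative is assumed to exist, its value can be read off from positive increments
    alone. *)
Lemma is_derive_eq_right_germ (G : R -> R) c l r :
  0 < r -> (forall h, 0 <= h < r -> G h = c * h) -> is_derive G 0 l -> l = c.
Proof.
intros Hr HG Hl; apply is_derive_Reals in Hl.
destruct (Req_dec l c) as [|Hne]; [assumption|exfalso].
assert (He : 0 < Rabs (c - l)) by (apply Rabs_pos_lt; lra).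
destruct (Hl _ He) as [d Hd].
assert (Hd0 := cond_pos d).
(* An increment inside both the range where [G] is linear and the range where its difference
   quotient is within [Rabs (c - l)] of [l]. *)
set (h := Rmin d r / 2).
assert (Hm : 0 < Rmin d r) by now apply Rmin_glb_lt.
assert (Hm1 := Rmin_l d r); assert (Hm2 := Rmin_r d r).
assert (Hh : 0 < h < d /\ h < r) by (unfold h; lra).
specialize (Hd h); rewrite Rplus_0_l, !HG in Hd by lra.
replace ((c * h - c * 0) / h - l) with (c - l) in Hd by (field; lra).
apply (Rlt_irrefl (Rabs (c - l))), Hd; [lra|].
rewrite Rabs_pos_eq; lra.
Qed.

Lemma continuous_R_mult {T : UniformSpace} (f g : T -> R) x :
  continuous f x -> continuous g x -> continuous (fun t => f t * g t) x.
Proof. exact (@continuous_mult T R_AbsRing f g x). Qed.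
Lemma continuous_R_plus {T : UniformSpace} (f g : T -> R) x :
  continuous f x -> continuous g x -> continuous (fun t => f t + g t) x.
Proof. exact (@continuous_plus T R_AbsRing R_NormedModule f g x). Qed.

Lemma abs_scal_trig_le r t R0 : Rabs r < R0 -> Rabs t <= 1 -> Rabs (r * t) < R0.
Proof.
intros Hr Ht; rewrite Rabs_mult.
apply Rle_lt_trans with (Rabs r * 1); [|lra].
apply Rmult_le_compat_l; [apply Rabs_pos|exact Ht].
Qed.

Lemma continuous_cos_comp {T : UniformSpace} (g : T -> R) x :
  continuous g x -> continuous (fun t => cos (g t)) x.
Proof. intros Hg; exact (continuous_comp g cos x Hg (continuous_cos _)). Qed.
Lemma continuous_sin_comp {T : UniformSpace} (g : T -> R) x :
  continuous g x -> continuous (fun t => sin (g t)) x.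
Proof. intros Hg; exact (continuous_comp g sin x Hg (continuous_sin _)). Qed.

Lemma continuous_fst_comp {T U V: UniformSpace} (g : T -> U * V) x :
  continuous g x -> continuous (fun t => fst (g t)) x.
Proof. intros Hg; apply (continuous_comp g fst x Hg), continuous_fst. Qed.
Lemma continuous_snd_comp {T U V : UniformSpace} (g : T -> U * V) x :
  continuous g x -> continuous (fun t => snd (g t)) x.
Proof. intros Hg; apply (continuous_comp g snd x Hg), continuous_snd. Qed.

Ltac cont :=
  repeat lazymatch goal with
    | |- continuous (fun t => t) _ => apply continuous_id
    | |- continuous (fun _ => ?c) _ => apply continuous_const
    | |- continuous (fun _ => fst _) _ => apply continuous_fst_comp
    | |- continuous (fun _ => snd _) _ => apply continuous_snd_comp
    | |- continuous (fun _ => _ + _) _ => apply continuous_R_plus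
    | |- continuous (fun _ => _ * _) _ => apply continuous_R_mult
    | |- continuous (fun _ => cos _) _ => apply continuous_cos_comp
    | |- continuous (fun _ => sin _) _ => apply continuous_sin_comp
    | |- continuous cos _ => apply continuous_cos
    | |- continuous sin _ => apply continuous_sin
    | |- continuous fst _ => apply continuous_fst
    | |- continuous snd _ => apply continuous_snd
    end.

Lemma abs_cos_le t : Rabs (cos t) <= 1.
Proof. apply Rabs_le, COS_bound. Qed.
Lemma abs_sin_le t : Rabs (sin t) <= 1.
Proof. apply Rabs_le, SIN_bound. Qed.

Lemma RInt_const_R (c a b : R) : RInt (fun _ => c) a b = (b - a) * c.
Proof. rewrite RInt_const; reflexivity. Qed.

(** * Circle integrals about a fixed centre *)

Section Circle.

Variables (D : R -> R -> Prop) (a b : R -> R -> R).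
Hypotheses (HD : open_2d D) (Ha : C1_2d D a) (Hb : C1_2d D b)
  (HCR : cauchy_riemann D a b).

(* Real part of F(z + r e^(i t)) e^(-i t), for F = a + i b and z = x + i y. *)
Definition cauchy_kernel (x y r t : R) : R :=
  a (x + r * cos t) (y + r * sin t) * cos t
  + b (x + r * cos t) (y + r * sin t) * sin t.

Definition cauchy_int (x y r : R) : R := RInt (cauchy_kernel x y r) 0 (2 * PI).

Variables (x y rho : R).
Hypothesis Hball : forall u v, Rabs (u - x) < rho -> Rabs (v - y) < rho -> D u v.

Lemma circle_in r t : Rabs r < rho -> D (x + r * cos t) (y + r * sin t).
Proof.
intros Hr; apply Hball.
- replace (x + r * cos t - x) with (r * cos t) by ring.
  apply abs_scal_trig_le; [exact Hr|apply abs_cos_le].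
- replace (y + r * sin t - y) with (r * sin t) by ring.
  apply abs_scal_trig_le; [exact Hr|apply abs_sin_le].
Qed.

(** The radial derivative of F(z + r e^(it)) is F' e^(it). The factor e^(-it) cancels the rotation,
    and the real part of F' is [pu a]. *)
Lemma cauchy_kernel_dr r t :
  Rabs r < rho ->
  is_derive (fun s => cauchy_kernel x y s t) r
    (pu a (x + r * cos t) (y + r * sin t)).
Proof.
intros Hr; assert (Hin := circle_in r t Hr).
destruct (HCR _ _ Hin) as [E1 E2].
assert (Hx : is_derive (fun s => x + s * cos t) r (cos t))
  by (auto_derive; [easy|ring]).
assert (Hy : is_derive (fun s => y + s * sin t) r (sin t))
  by (auto_derive; [easy|ring]).
assert (Ka := C1_2d_chain D a (fun s => x + s * cos t)
  (fun s => y + s * sin t) r _ _ HD Ha Hin Hx Hy).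
assert (Kb := C1_2d_chain D b (fun s => x + s * cos t)
  (fun s => y + s * sin t) r _ _ HD Hb Hin Hx Hy).
cbv beta in Ka, Kb.
rewrite E2 in Ka; rewrite <- E1 in Kb.
set (A := pu a _ _) in *; set (B := pu b _ _) in *.
replace A with ((A * cos t + - B * sin t) * cos t
  + (B * cos t + A * sin t) * sin t).
- apply (is_derive_plus (K := R_AbsRing) (V := R_NormedModule)).
  + apply (is_derive_scal_l (K := R_AbsRing) (V := R_NormedModule)); exact Ka.
  + apply (is_derive_scal_l (K := R_AbsRing) (V := R_NormedModule)); exact Kb.
- generalize (sin2_cos2 t); unfold Rsqr; intros H.
  transitivity (A * (sin t * sin t + cos t * cos t)); [ring|rewrite H; ring].
Qed.

(** Radius and angle are functions on an arbitrary space [T], so one statement covers continuity in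
    the angle alone and joint continuity in both. *)
Lemma continuous_C1_circle {T : UniformSpace} (g : R -> R -> R) (r t : T -> R) s :
  (forall u v, D u v -> continuous (fun p : R * R => g (fst p) (snd p)) (u, v)) ->
  Rabs (r s) < rho -> continuous r s -> continuous t s ->
  continuous (fun s => g (x + r s * cos (t s)) (y + r s * sin (t s))) s.
Proof.
intros Hg Hr Cr Ct.
apply (continuous_comp_2 (fun s => x + r s * cos (t s))
         (fun s => y + r s * sin (t s)) g); cont; try assumption.
now apply Hg, circle_in.
Qed.

Lemma continuous_cauchy_kernel r t :
  Rabs r < rho -> continuous (cauchy_kernel x y r) t.
Proof.
intros Hr; unfold cauchy_kernel; cont.
- apply (continuous_C1_circle a (fun _ => r) (fun t => t)); try assumption; cont.
  intros; now apply (C1_2d_continuous D).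
- apply (continuous_C1_circle b (fun _ => r) (fun t => t)); try assumption; cont.
  intros; now apply (C1_2d_continuous D).
Qed.

Lemma cauchy_int_derive r :
  Rabs r < rho ->
  is_derive (cauchy_int x y) r
    (RInt (fun t => pu a (x + r * cos t) (y + r * sin t)) 0 (2 * PI)).
Proof.
intros Hr.
assert (Hz : forall z, Rabs (z - r) < rho - Rabs r -> Rabs z < rho).
{ intros z Hz; replace z with ((z - r) + r) by ring.
  eapply Rle_lt_trans; [apply Rabs_triang|lra]. }
apply (is_derive_RInt_param_C1 (cauchy_kernel x y)
  (fun r t => pu a (x + r * cos t) (y + r * sin t)) 0 (2 * PI) r
  (rho - Rabs r)).
- lra.
- intros z t H; apply cauchy_kernel_dr; auto.
- intros t; apply (continuous_C1_circle (pu a) fst snd); cont; try assumption.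
  intros u v Huv; apply (proj1 (proj2 (proj2 (Ha u v Huv)))).
- intros z t H; apply continuous_cauchy_kernel; auto.
Qed.

(* The angular derivative of Im (F(z + r e^(i t)) e^(-i t)), which integrates
   to 0 over a period, is the difference of the two integrands. *)
Lemma cauchy_int_ode r :
  Rabs r < rho ->
  cauchy_int x y r
  = r * RInt (fun t => pu a (x + r * cos t) (y + r * sin t)) 0 (2 * PI).
Proof.
intros Hr.
set (h := fun t => pu a (x + r * cos t) (y + r * sin t)).
assert (Ch : forall t, continuous h t).
{ intros t; apply (continuous_C1_circle (pu a) (fun _ => r) (fun t => t));
    try assumption; cont.
  intros u v Huv; apply (proj1 (proj2 (proj2 (Ha u v Huv)))). }
(* Minus the imaginary part of F(z + r e^(it)) e^(-it); the sign makes its derivative the kernel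
   minus [r * h t]. *)
set (P := fun t => a (x + r * cos t) (y + r * sin t) * sin t
                   - b (x + r * cos t) (y + r * sin t) * cos t).
assert (HP : forall t, is_derive P t (cauchy_kernel x y r t - r * h t)).
{ intros t; assert (Hin := circle_in r t Hr).
  destruct (HCR _ _ Hin) as [E1 E2].
  assert (Hx : is_derive (fun s => x + r * cos s) t (- r * sin t))
    by (auto_derive; [easy|ring]).
  assert (Hy : is_derive (fun s => y + r * sin s) t (r * cos t))
    by (auto_derive; [easy|ring]).
  assert (Ka := C1_2d_chain D a (fun s => x + r * cos s)
    (fun s => y + r * sin s) t _ _ HD Ha Hin Hx Hy).
  assert (Kb := C1_2d_chain D b (fun s => x + r * cos s)
    (fun s => y + r * sin s) t _ _ HD Hb Hin Hx Hy).
  cbv beta in Ka, Kb.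
  rewrite E2 in Ka; rewrite <- E1 in Kb.
  unfold P, h, cauchy_kernel.
  set (A := pu a _ _) in *; set (B := pu b _ _) in *.
  evar_last.
  - apply (is_derive_minus (K := R_AbsRing) (V := R_NormedModule)).
    + apply (is_derive_mult (K := R_AbsRing)); [exact Ka| |apply Rmult_comm].
      apply is_derive_Reals, derivable_pt_lim_sin.
    + apply (is_derive_mult (K := R_AbsRing)); [exact Kb| |apply Rmult_comm].
      apply is_derive_Reals, derivable_pt_lim_cos.
  - unfold minus, plus, opp, mult; simpl.
    generalize (sin2_cos2 t); unfold Rsqr; intros H.
    transitivity (a (x + r * cos t) (y + r * sin t) * cos t
      + b (x + r * cos t) (y + r * sin t) * sin t
      - r * (A * (sin t * sin t + cos t * cos t))); [ring|rewrite H; ring]. }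
assert (I0 := is_RInt_derive (V := R_CompleteNormedModule) P
  (fun t => cauchy_kernel x y r t - r * h t) 0 (2 * PI) (fun t _ => HP t)).
assert (E0 : minus (P (2 * PI)) (P 0) = 0).
{ unfold P; rewrite cos_2PI, sin_2PI, cos_0, sin_0.
  unfold minus, plus, opp; simpl; ring. }
assert (Ik : ex_RInt (cauchy_kernel x y r) 0 (2 * PI)).
{ apply (ex_RInt_continuous (V := R_CompleteNormedModule)).
  intros t _; now apply continuous_cauchy_kernel. }
assert (Ih : ex_RInt (fun t => r * h t) 0 (2 * PI)).
{ apply (ex_RInt_continuous (V := R_CompleteNormedModule)).
  intros t _; cont; apply Ch. }
assert (I1 : RInt (fun t => cauchy_kernel x y r t - r * h t) 0 (2 * PI) = 0).
{ etransitivity; [apply is_RInt_unique, I0|exact E0]; intros t _.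
  apply (continuous_minus (V := R_NormedModule)).
  - now apply continuous_cauchy_kernel.
  - cont; apply Ch. }
rewrite (RInt_minus (V := R_CompleteNormedModule)) in I1 by assumption.
rewrite (RInt_scal (V := R_CompleteNormedModule)) in I1.
- unfold cauchy_int; unfold minus, plus, opp, scal in I1; simpl in I1.
  unfold mult in I1; simpl in I1; lra.
- apply (ex_RInt_continuous (V := R_CompleteNormedModule)).
  intros t _; apply Ch.
Qed.

(** Write J(r) for the circle integral. The two preceding lemmas give J = r J', so J(r)/r is
    constant on positive radii. As J(0) = 0, that constant is J'(0), where the circle has shrunk to
    its centre. The result is the real part of Cauchy's formula for F'(z). *)
Lemma cauchy_formula r :
  0 < r < rho -> cauchy_int x y r = 2 * PI * r * pu a x y.
Proof.
intros Hr.
assert (Habs : forall s, 0 <= s <= r -> Rabs s < rho)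
  by (intros s Hs; rewrite Rabs_pos_eq; lra).
(* The quotient rule gives (J' s - J)/s^2, which vanishes by J = s J'. *)
assert (K : forall s, 0 < s <= r -> cauchy_int x y s / s = cauchy_int x y r / r).
{ intros s Hs; destruct (Req_dec s r) as [->|Hne]; [reflexivity|].
  apply (eq_is_derive (V := R_NormedModule) (fun s => cauchy_int x y s / s));
    [|lra].
  intros t Ht.
  assert (Ht' : Rabs t < rho) by (apply Habs; lra).
  assert (Dt := cauchy_int_derive t Ht').
  evar_last.
  - apply is_derive_div; [exact Dt|apply (is_derive_id (K := R_AbsRing))|lra].
  - rewrite (cauchy_int_ode t Ht'); unfold one, zero; simpl; field; lra. }
(* At radius 0 the integrand is the constant [pu a x y]. *)
assert (H0 : is_derive (cauchy_int x y) 0 (2 * PI * pu a x y)).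
{ evar_last; [apply cauchy_int_derive; rewrite Rabs_R0; lra|].
  rewrite (RInt_ext _ (fun _ => pu a x y)).
  - rewrite RInt_const_R; ring.
  - intros t _; now rewrite !Rmult_0_l, !Rplus_0_r. }
assert (E : 2 * PI * pu a x y = cauchy_int x y r / r).
{ apply (is_derive_eq_right_germ (cauchy_int x y) _ _ r); [lra| |exact H0].
  intros h Hh; destruct (Req_dec h 0) as [->|Hh0].
  - rewrite cauchy_int_ode by (rewrite Rabs_R0; lra); ring.
  - rewrite <- (K h) by lra; field; exact Hh0. }
transitivity (cauchy_int x y r / r * r); [field; lra|rewrite <- E; ring].
Qed.

End Circle.

(** * Circle integrals with a moving centre *)

(** Only continuity of [g] and [h] is asked for, so that the kernel may be built from [a], [b] or
    from their first partials. *)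
Lemma continuous_cauchy_kernel_param {T : UniformSpace} (D : R -> R -> Prop)
  (g h : R -> R -> R) (x y t : T -> R) r s :
  (forall u v, D u v -> continuous (fun p : R * R => g (fst p) (snd p)) (u, v)) ->
  (forall u v, D u v -> continuous (fun p : R * R => h (fst p) (snd p)) (u, v)) ->
  D (x s + r * cos (t s)) (y s + r * sin (t s)) ->
  continuous x s -> continuous y s -> continuous t s ->
  continuous (fun s => cauchy_kernel g h (x s) (y s) r (t s)) s.
Proof.
intros Hg Hh Hin Cx Cy Ct; unfold cauchy_kernel; cont; try assumption.
- apply (continuous_comp_2 (fun s => x s + r * cos (t s))
         (fun s => y s + r * sin (t s)) g); cont; try assumption.
  now apply Hg.
- apply (continuous_comp_2 (fun s => x s + r * cos (t s))
         (fun s => y s + r * sin (t s)) h); cont; try assumption.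
  now apply Hh.
Qed.

(** This is where regularity is gained: moving the centre differentiates only the integrand, which
    costs one derivative of [a] and [b]. The factor 2 in the box leaves room for a displacement of
    the centre by less than [rho] and a radius below [rho]. *)
Lemma cauchy_int_dx D a b x y r rho :
  open_2d D -> C1_2d D a -> C1_2d D b ->
  0 < r < rho ->
  (forall u v, Rabs (u - x) < 2 * rho -> Rabs (v - y) < 2 * rho -> D u v) ->
  is_derive (fun z => cauchy_int a b z y r) x (cauchy_int (pu a) (pu b) x y r).
Proof.
intros HD Ha Hb Hr Hball.
assert (Hz : forall z t, Rabs (z - x) < rho ->
  D (z + r * cos t) (y + r * sin t)).
{ intros z t Hz; apply (circle_in D z y rho).
  - intros u v Hu Hv; apply Hball; [|lra].
    replace (u - x) with ((u - z) + (z - x)) by ring.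
    eapply Rle_lt_trans; [apply Rabs_triang|lra].
  - rewrite Rabs_pos_eq; lra. }
assert (Hx : Rabs (x - x) < rho) by (rewrite Rminus_diag, Rabs_R0; lra).
apply (is_derive_RInt_param_C1 (fun z => cauchy_kernel a b z y r)
  (fun z => cauchy_kernel (pu a) (pu b) z y r) _ _ _ rho).
- lra.
- intros z t H; specialize (Hz z t H).
  assert (Dx : is_derive (fun s => s + r * cos t) z 1)
    by (auto_derive; [easy|ring]).
  assert (Dy : is_derive (fun s : R => y + r * sin t) z 0)
    by (apply (is_derive_const (K := R_AbsRing) (V := R_NormedModule))).
  assert (Ka := C1_2d_chain D a (fun s => s + r * cos t)
    (fun s => y + r * sin t) z _ _ HD Ha Hz Dx Dy).
  assert (Kb := C1_2d_chain D b (fun s => s + r * cos t)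
    (fun s => y + r * sin t) z _ _ HD Hb Hz Dx Dy).
  cbv beta in Ka, Kb; rewrite Rmult_1_r, Rmult_0_r, Rplus_0_r in Ka, Kb.
  apply (is_derive_plus (K := R_AbsRing) (V := R_NormedModule)).
  + apply (is_derive_scal_l (K := R_AbsRing) (V := R_NormedModule)); exact Ka.
  + apply (is_derive_scal_l (K := R_AbsRing) (V := R_NormedModule)); exact Kb.
- intros t.
  apply (continuous_cauchy_kernel_param D _ _ fst (fun _ => y) snd);
    cont; try (now apply Hz); intros u v Huv.
  + apply (proj1 (proj2 (proj2 (Ha u v Huv)))).
  + apply (proj1 (proj2 (proj2 (Hb u v Huv)))).
- intros z t H.
  apply (continuous_cauchy_kernel_param D _ _ (fun _ => z) (fun _ => y) (fun t => t));
    cont; try (now apply Hz); intros u v Huv; now apply (C1_2d_continuous D).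
Qed.

Lemma cauchy_int_dy D a b x y r rho :
  open_2d D -> C1_2d D a -> C1_2d D b ->
  0 < r < rho ->
  (forall u v, Rabs (u - x) < 2 * rho -> Rabs (v - y) < 2 * rho -> D u v) ->
  is_derive (fun z => cauchy_int a b x z r) y (cauchy_int (pv a) (pv b) x y r).
Proof.
intros HD Ha Hb Hr Hball.
assert (Hz : forall z t, Rabs (z - y) < rho ->
  D (x + r * cos t) (z + r * sin t)).
{ intros z t Hz; apply (circle_in D x z rho).
  - intros u v Hu Hv; apply Hball; [lra|].
    replace (v - y) with ((v - z) + (z - y)) by ring.
    eapply Rle_lt_trans; [apply Rabs_triang|lra].
  - rewrite Rabs_pos_eq; lra. }
assert (Hx : Rabs (y - y) < rho) by (rewrite Rminus_diag, Rabs_R0; lra).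
apply (is_derive_RInt_param_C1 (fun z => cauchy_kernel a b x z r)
  (fun z => cauchy_kernel (pv a) (pv b) x z r) _ _ _ rho).
- lra.
- intros z t H; specialize (Hz z t H).
  assert (Dx : is_derive (fun s => s + r * sin t) z 1)
    by (auto_derive; [easy|ring]).
  assert (Dy : is_derive (fun s : R => x + r * cos t) z 0)
    by (apply (is_derive_const (K := R_AbsRing) (V := R_NormedModule))).
  assert (Ka := C1_2d_chain D a (fun s => x + r * cos t)
    (fun s => s + r * sin t) z _ _ HD Ha Hz Dy Dx).
  assert (Kb := C1_2d_chain D b (fun s => x + r * cos t)
    (fun s => s + r * sin t) z _ _ HD Hb Hz Dy Dx).
  cbv beta in Ka, Kb; rewrite Rmult_1_r, Rmult_0_r, Rplus_0_l in Ka, Kb.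
  apply (is_derive_plus (K := R_AbsRing) (V := R_NormedModule)).
  + apply (is_derive_scal_l (K := R_AbsRing) (V := R_NormedModule)); exact Ka.
  + apply (is_derive_scal_l (K := R_AbsRing) (V := R_NormedModule)); exact Kb.
- intros t.
  apply (continuous_cauchy_kernel_param D _ _ (fun _ => x) fst snd);
    cont; try (now apply Hz); intros u v Huv.
  + apply (proj2 (proj2 (proj2 (Ha u v Huv)))).
  + apply (proj2 (proj2 (proj2 (Hb u v Huv)))).
- intros z t H.
  apply (continuous_cauchy_kernel_param D _ _ (fun _ => x) (fun _ => z) (fun t => t));
    cont; try (now apply Hz); intros u v Huv; now apply (C1_2d_continuous D).
Qed.

(** * Second derivatives and harmonicity of Cauchy-Riemann pairs *)

Lemma pu_opp a u v : pu (fun x y => - a x y) u v = - pu a u v.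
Proof. apply Derive_opp. Qed.
Lemma pv_opp a u v : pv (fun x y => - a x y) u v = - pv a u v.
Proof. apply Derive_opp. Qed.

Lemma C1_2d_opp D a : C1_2d D a -> C1_2d D (fun x y => - a x y).
Proof.
intros Ha u v Huv; destruct (Ha u v Huv) as (H1 & H2 & H3 & H4); repeat split.
- now apply (ex_derive_opp (K := R_AbsRing) (V := R_NormedModule)).
- now apply (ex_derive_opp (K := R_AbsRing) (V := R_NormedModule)).
- eapply continuous_ext; [intros p; symmetry; apply pu_opp|].
  now apply (continuous_opp (V := R_NormedModule)).
- eapply continuous_ext; [intros p; symmetry; apply pv_opp|].
  now apply (continuous_opp (V := R_NormedModule)).
Qed.

(** The pair (b, -a) represents -i F when (a, b) represents F. *)
Lemma cauchy_riemann_conj D a b :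
  cauchy_riemann D a b -> cauchy_riemann D b (fun x y => - a x y).
Proof.
intros H u v Huv; destruct (H u v Huv) as [E1 E2].
rewrite pu_opp, pv_opp; split; lra.
Qed.

(** By Cauchy's formula [pu a] is locally a constant multiple of a circle integral, hence
    differentiable in the centre. The same applied to -i F handles [pu b], which is [- pv a]. Using
    the single value [A] in both conclusions expresses harmonicity. *)
Lemma cauchy_riemann_second D a b u v :
  open_2d D -> C1_2d D a -> C1_2d D b -> cauchy_riemann D a b -> D u v ->
  exists A, is_derive (fun x => pu a x v) u A /\
            is_derive (fun y => pv a u y) v (- A).
Proof.
intros HD Ha Hb HCR Huv.
destruct (HD u v Huv) as [d Hd].
assert (Hd0 := cond_pos d).
(* The box of half-width [2 * rho] is exactly the given neighbourhood, and [r] lies strictly below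
   [rho]. *)
set (rho := d / 2); set (r := d / 4).
assert (Hr : 0 < r < rho) by (unfold r, rho; lra).
assert (Hball : forall x y, Rabs (x - u) < 2 * rho -> Rabs (y - v) < 2 * rho -> D x y)
  by (unfold rho; intros x y Hx Hy; apply Hd; lra).
assert (Hpi := PI_RGT_0).
exists (/ (2 * PI * r) * cauchy_int (pu a) (pu b) u v r); split.
- apply (is_derive_ext_loc (fun x => / (2 * PI * r) * cauchy_int a b x v r)).
  + exists (mkposreal rho ltac:(lra)); intros x Hx; change (Rabs (x - u) < rho) in Hx.
    assert (E : cauchy_int a b x v r = 2 * PI * r * pu a x v).
    { apply (cauchy_formula D a b HD Ha Hb HCR x v rho); [|exact Hr].
      intros z w Hz Hw; apply Hball; [|lra].
      replace (z - u) with ((z - x) + (x - u)) by ring.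
      eapply Rle_lt_trans; [apply Rabs_triang|lra]. }
    rewrite E; change (/ (2 * PI * r) * (2 * PI * r * pu a x v) = pu a x v).
    field; lra.
  + apply (is_derive_scal (fun x => cauchy_int a b x v r)).
    now apply (cauchy_int_dx D a b u v r rho).
- apply (is_derive_ext_loc
    (fun y => - / (2 * PI * r) * cauchy_int b (fun x y => - a x y) u y r)).
  + exists (mkposreal rho ltac:(lra)); intros y Hy; change (Rabs (y - v) < rho) in Hy.
    assert (E : cauchy_int b (fun x y => - a x y) u y r = 2 * PI * r * pu b u y).
    { apply (cauchy_formula D b (fun x y => - a x y) HD Hb (C1_2d_opp D a Ha)
        (cauchy_riemann_conj D a b HCR) u y rho); [|exact Hr].
      intros z w Hz Hw; apply Hball; [lra|].
      replace (w - v) with ((w - y) + (y - v)) by ring.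
      eapply Rle_lt_trans; [apply Rabs_triang|lra]. }
    assert (Hin : D u y) by (apply Hball; rewrite ?Rminus_diag, ?Rabs_R0; lra).
    rewrite E, (proj2 (HCR u y Hin)).
    change (- / (2 * PI * r) * (2 * PI * r * pu b u y) = - pu b u y).
    field; lra.
  + evar_last.
    * apply (is_derive_scal (fun y => cauchy_int b (fun x y => - a x y) u y r)).
      apply (cauchy_int_dy D b _ u v r rho); auto using C1_2d_opp.
    (* Under the integral the Cauchy-Riemann equations turn [pv b] into [pu a] and [- pv a] into
       [pu b], so both second derivatives come from one integral. *)
    * assert (E : cauchy_int (pv b) (pv (fun x y => - a x y)) u v r
        = cauchy_int (pu a) (pu b) u v r).
      { apply RInt_ext; intros t _; unfold cauchy_kernel.
        assert (Hin : D (u + r * cos t) (v + r * sin t)).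
        { apply (circle_in D u v (2 * rho) Hball); rewrite Rabs_pos_eq; lra. }
        destruct (HCR _ _ Hin) as [E1 E2].
        rewrite pv_opp, E1, E2; apply f_equal2; ring. }
      rewrite E; apply Ropp_mult_distr_l_reverse.
Qed.

(** * Derivatives of quaternion-valued functions *)

Lemma quat_ext (p q : quat) :
  q0 p = q0 q -> q1 p = q1 q -> q2 p = q2 q -> q3 p = q3 q -> p = q.
Proof.
destruct p as [[[p0 p1] p2] p3], q as [[[r0 r1] r2] r3].
unfold q0, q1, q2, q3; simpl; now intros -> -> -> ->.
Qed.

Ltac qunfold :=
  unfold qsub, qadd, qmul, qopp, qvec, RtoQ, e1, e2, e3, mkq, q0, q1, q2, q3 in *;
  cbn [fst snd] in *.
(* Weak reduction selects the required coordinate of each factor before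
   expanding it, so that nested products do not blow up. *)
Ltac qcoord :=
  cbn [qsub qadd qmul qopp qvec RtoQ e1 e2 e3 mkq q0 q1 q2 q3 fst snd].
Ltac qring := apply quat_ext; qcoord; ring.

(** Coordinatewise form, matching [qDerive]: it carries existence together with the value and
    reduces every rule to real calculus. *)
Definition is_qderive (g : R -> quat) (t : R) (l : quat) : Prop :=
  is_derive (fun s => q0 (g s)) t (q0 l) /\ is_derive (fun s => q1 (g s)) t (q1 l) /\
  is_derive (fun s => q2 (g s)) t (q2 l) /\ is_derive (fun s => q3 (g s)) t (q3 l).

Lemma is_qderive_unique g t l : is_qderive g t l -> qDerive g t = l.
Proof.
intros (H0 & H1 & H2 & H3); apply quat_ext; unfold qDerive;
  now apply is_derive_unique.
Qed.

(** Needed to pass from coordinate derivatives to differentiability in the product module, the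
    notion used by [ex_partial] and [C1_on]. *)
Lemma is_derive_pair {U V : NormedModule R_AbsRing} (f : R -> U) (g : R -> V) t lf lg :
  is_derive f t lf -> is_derive g t lg ->
  is_derive (V := prod_NormedModule R_AbsRing U V) (fun s => (f s, g s)) t (lf, lg).
Proof.
intros Hf Hg.
apply filterdiff_ext_lin with (fun y : R => (scal y lf, scal y lg)).
- apply (filterdiff_comp'_2 f g (fun x y => (x, y)) t _ _ (fun x y => (x, y)) Hf Hg).
  apply (filterdiff_ext (fun x => x)); [now intros []|].
  apply (filterdiff_ext_lin _ (fun x => x)); [apply filterdiff_id|now intros []].
- reflexivity.
Qed.

Lemma is_qderive_ex g t l : is_qderive g t l -> ex_derive g t.
Proof.
intros (H0 & H1 & H2 & H3); eexists.
apply (is_derive_ext (fun s => (q0 (g s), q1 (g s), q2 (g s), q3 (g s)))).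
- intros s; now destruct (g s) as [[[? ?] ?] ?].
- repeat apply is_derive_pair; eassumption.
Qed.

Lemma ex_derive_fst {U V : NormedModule R_AbsRing} (g : R -> U * V) t :
  ex_derive (V := prod_NormedModule R_AbsRing U V) g t ->
  ex_derive (fun s => fst (g s)) t.
Proof.
intros [l Hl]; exists (fst l).
apply (filterdiff_comp' (V := prod_NormedModule R_AbsRing U V) g
  (fun p => fst p) t _ (fun p => fst p) Hl).
apply filterdiff_linear, is_linear_fst.
Qed.

Lemma ex_derive_snd {U V : NormedModule R_AbsRing} (g : R -> U * V) t :
  ex_derive (V := prod_NormedModule R_AbsRing U V) g t ->
  ex_derive (fun s => snd (g s)) t.
Proof.
intros [l Hl]; exists (snd l).
apply (filterdiff_comp' (V := prod_NormedModule R_AbsRing U V) g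
  (fun p => snd p) t _ (fun p => snd p) Hl).
apply filterdiff_linear, is_linear_snd.
Qed.

(** The converse passage: projections are linear, so each coordinate inherits differentiability. *)
Lemma ex_is_qderive (g : R -> quat) t : ex_derive g t -> is_qderive g t (qDerive g t).
Proof.
intros Hg; assert (H2 := ex_derive_fst _ _ Hg); assert (H1 := ex_derive_fst _ _ H2).
split; [|split; [|split]]; apply Derive_correct.
- exact (ex_derive_fst _ _ H1).
- exact (ex_derive_snd _ _ H1).
- exact (ex_derive_snd _ _ H2).
- exact (ex_derive_snd _ _ Hg).
Qed.

Lemma is_qderive_ext_loc f g t l :
  locally t (fun s => f s = g s) -> is_qderive f t l -> is_qderive g t l.
Proof.
intros E (H0 & H1 & H2 & H3); split; [|split; [|split]];
  (eapply is_derive_ext_loc; [|eassumption]);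
  (apply filter_imp with (2 := E); intros s Hs; now rewrite Hs).
Qed.

Lemma is_qderive_eq g t l l' : is_qderive g t l -> l = l' -> is_qderive g t l'.
Proof. now intros H <-. Qed.

Lemma is_derive_Rmult (f g : R -> R) (t f' g' : R) :
  is_derive f t f' -> is_derive g t g' ->
  is_derive (fun s => f s * g s) t (f' * g t + f t * g').
Proof.
intros Hf Hg; apply (is_derive_mult (K := R_AbsRing) f g t f' g' Hf Hg Rmult_comm).
Qed.
Lemma is_derive_Rplus (f g : R -> R) (t f' g' : R) :
  is_derive f t f' -> is_derive g t g' -> is_derive (fun s => f s + g s) t (f' + g').
Proof. apply (is_derive_plus (K := R_AbsRing) (V := R_NormedModule)). Qed.
Lemma is_derive_Rminus (f g : R -> R) (t f' g' : R) :
  is_derive f t f' -> is_derive g t g' -> is_derive (fun s => f s - g s) t (f' - g').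
Proof. apply (is_derive_minus (K := R_AbsRing) (V := R_NormedModule)). Qed.
Lemma is_derive_Rconst (c t : R) : is_derive (fun _ : R => c) t 0.
Proof. apply (is_derive_const (K := R_AbsRing) (V := R_NormedModule)). Qed.

Lemma is_qderive_const c t : is_qderive (fun _ => c) t (RtoQ 0).
Proof. split; [|split; [|split]]; apply is_derive_Rconst. Qed.

Lemma is_qderive_RtoQ (f : R -> R) (t f' : R) :
  is_derive f t f' -> is_qderive (fun s => RtoQ (f s)) t (RtoQ f').
Proof.
intros H; split; [exact H|split; [|split]]; exact (is_derive_Rconst 0 t).
Qed.

Lemma is_qderive_add f g t f' g' :
  is_qderive f t f' -> is_qderive g t g' ->
  is_qderive (fun s => f s + g s)%quat t (f' + g')%quat.
Proof.
intros (F0 & F1 & F2 & F3) (G0 & G1 & G2 & G3).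
split; [|split; [|split]]; now apply is_derive_Rplus.
Qed.

Lemma is_derive_Req (f : R -> R) (t l l' : R) : is_derive f t l -> l = l' -> is_derive f t l'.
Proof. now intros H <-. Qed.

Lemma is_qderive_mul (f g : R -> quat) t f' g' :
  is_qderive f t f' -> is_qderive g t g' ->
  is_qderive (fun s => f s * g s)%quat t (f' * g t + f t * g')%quat.
Proof.
intros (F0 & F1 & F2 & F3) (G0 & G1 & G2 & G3).
unfold is_qderive; qunfold.
split; [|split; [|split]]; (eapply is_derive_Req;
 [ repeat lazymatch goal with
   | |- is_derive (fun _ => _ - _) _ _ => eapply is_derive_Rminus
   | |- is_derive (fun _ => _ + _) _ _ => eapply is_derive_Rplus
   | |- is_derive (fun _ => _ * _) _ _ => eapply is_derive_Rmult; eassumption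
   end
 | cbv beta; ring ]).
Qed.

Lemma is_qderive_comp (g : R -> quat) (h : R -> R) t dg (dh : R) :
  is_qderive g (h t) dg -> is_derive h t dh ->
  is_qderive (fun s => g (h s)) t (RtoQ dh * dg)%quat.
Proof.
intros (G0 & G1 & G2 & G3) H.
assert (K : forall k d, is_derive (k : R -> R) (h t) d ->
  is_derive (fun s => k (h s)) t (dh * d)).
{ intros k d Hk; exact (is_derive_comp (V := R_NormedModule) k h t d dh Hk H). }
split; [|split; [|split]]; eapply is_derive_Req.
all: [> exact (K (fun y => q0 (g y)) _ G0) | | exact (K (fun y => q1 (g y)) _ G1)
  | | exact (K (fun y => q2 (g y)) _ G2) | | exact (K (fun y => q3 (g y)) _ G3) | ].
all: unfold qmul, RtoQ, mkq, q0, q1, q2, q3; cbn [fst snd]; ring.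
Qed.

(* [d] and [l] are the first and second derivatives of [f] at [p] along [e]. *)
Definition is_partial2 (e : quat) (f : quat -> quat) (p : quat) (d l : quat) : Prop :=
  exists g' : R -> quat, g' 0 = d /\
    locally 0 (fun t => is_qderive (fun s => f (p + RtoQ s * e)%quat) t (g' t)) /\
    is_qderive g' 0 l.

Lemma is_partial2_of_line e f p (g g' : R -> quat) l :
  locally 0 (fun t => f (p + RtoQ t * e)%quat = g t) ->
  locally 0 (fun t => is_qderive g t (g' t)) ->
  is_qderive g' 0 l -> is_partial2 e f p (g' 0) l.
Proof.
intros E Hg Hg'; exists g'; split; [reflexivity|split; [|exact Hg']].
(* A derivative at a parameter [t] near 0 requires the two functions to agree near [t], not only at
   [t]. *)
apply locally_locally in E.
generalize (filter_and _ _ E Hg); apply filter_imp; intros t [Et Ht].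
apply is_qderive_ext_loc with (2 := Ht).
apply filter_imp with (2 := Et); intros s Hs; now symmetry.
Qed.

(** The partial derivative at [p + t e] is the derivative at parameter [t] of the restriction to the
    line through [p], by the shift [s] to [t + s]. Iterated partials therefore reduce to calculus on
    one line. *)
Lemma is_partial2_correct e f p d l :
  is_partial2 e f p d l ->
  ex_partial e f p /\ partial e f p = d /\
  ex_partial e (partial e f) p /\ partial e (partial e f) p = l.
Proof.
intros (g' & <- & Hg & Hl).
assert (H0 := locally_singleton _ _ Hg).
assert (Hp : is_qderive (fun t => partial e f (p + RtoQ t * e)%quat) 0 l).
{ apply is_qderive_ext_loc with (2 := Hl).
  generalize Hg; apply filter_imp; intros t Ht; symmetry.
  unfold partial; apply is_qderive_unique.
  eapply is_qderive_eq.
  - apply (is_qderive_ext_loc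
      (fun s : R => f (p + RtoQ (t + s) * e)%quat)).
    + apply filter_forall; intros s; f_equal; qring.
    + apply (is_qderive_comp (fun s => f (p + RtoQ s * e)%quat) (fun s => t + s) 0 (g' t) 1).
      * rewrite Rplus_0_r; exact Ht.
      * auto_derive; [easy|ring].
  - qring. }
split; [|split; [|split]].
- exact (is_qderive_ex _ _ _ H0).
- exact (is_qderive_unique _ _ _ H0).
- exact (is_qderive_ex _ _ _ Hp).
- exact (is_qderive_unique _ _ _ Hp).
Qed.

(** * From real Cauchy-Riemann pairs to quaternion-valued ones *)

Definition coordinate (k : quat -> R) : Prop := k = q0 \/ k = q1 \/ k = q2 \/ k = q3.

Lemma coordinate_continuous k p : coordinate k -> continuous k p.
Proof.
assert (C2 : continuous (fun q : quat => fst (fst q)) p)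
  by (apply continuous_fst_comp, continuous_fst).
intros [->|[->|[->| ->]]].
- now apply continuous_fst_comp.
- now apply continuous_snd_comp.
- apply continuous_snd_comp, continuous_fst.
- apply continuous_snd.
Qed.

Lemma C1_on_coordinate D a k :
  coordinate k -> C1_on D a -> C1_2d D (fun u v => k (a u v)).
Proof.
intros Hk Ha u v Huv; destruct (Ha u v Huv) as (H1 & H2 & H3 & H4).
apply ex_is_qderive in H1, H2.
assert (C3 := continuous_comp _ k _ H3 (coordinate_continuous k _ Hk)).
assert (C4 := continuous_comp _ k _ H4 (coordinate_continuous k _ Hk)).
destruct H1 as (? & ? & ? & ?), H2 as (? & ? & ? & ?).
destruct Hk as [->|[->|[->| ->]]];
  (split; [|split; [|split; [exact C3|exact C4]]]); eexists; eassumption.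
Qed.

Lemma cauchy_riemann_coordinate D (a b : R -> R -> quat) k :
  coordinate k ->
  (forall u v, D u v -> (du a u v - dv b u v)%quat = RtoQ 0 /\
                        (dv a u v + du b u v)%quat = RtoQ 0) ->
  cauchy_riemann D (fun u v => k (a u v)) (fun u v => k (b u v)).
Proof.
intros Hk H u v Huv; destruct (H u v Huv) as [E1 E2].
unfold pu, pv.
destruct Hk as [->|[->|[->| ->]]]; split;
  [ apply (f_equal q0) in E1 | apply (f_equal q0) in E2
  | apply (f_equal q1) in E1 | apply (f_equal q1) in E2
  | apply (f_equal q2) in E1 | apply (f_equal q2) in E2
  | apply (f_equal q3) in E1 | apply (f_equal q3) in E2 ];
  unfold qsub, qadd, qopp, du, dv, qDerive, RtoQ, mkq in E1, E2;
  unfold q0, q1, q2, q3 in *; cbn [fst snd] in E1, E2; lra.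
Qed.

(** The Cauchy-Riemann system contains no quaternion product, so it splits into four real pairs. [A]
    comes from the pairs (a, b) and [B] from the pairs (b, -a). *)
Lemma slice_pair_second D a b u v :
  open_2d D -> C1_on D a -> C1_on D b ->
  (forall u v, D u v -> (du a u v - dv b u v)%quat = RtoQ 0 /\
                        (dv a u v + du b u v)%quat = RtoQ 0) ->
  D u v ->
  exists A B,
    is_qderive (fun x => du a x v) u A /\ is_qderive (fun y => dv a u y) v (- A)%quat /\
    is_qderive (fun x => du b x v) u B /\ is_qderive (fun y => dv b u y) v (- B)%quat.
Proof.
intros HD Ha Hb HCR Huv.
assert (K : forall k, coordinate k -> exists A B,
  (is_derive (fun x => pu (fun u v => k (a u v)) x v) u A /\
   is_derive (fun y => pv (fun u v => k (a u v)) u y) v (- A)) /\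
  (is_derive (fun x => pu (fun u v => k (b u v)) x v) u B /\
   is_derive (fun y => pv (fun u v => k (b u v)) u y) v (- B))).
{ intros k Hk.
  assert (Ca := C1_on_coordinate D a k Hk Ha).
  assert (Cb := C1_on_coordinate D b k Hk Hb).
  assert (CR := cauchy_riemann_coordinate D a b k Hk HCR).
  destruct (cauchy_riemann_second D _ _ u v HD Ca Cb CR Huv) as [A HA].
  destruct (cauchy_riemann_second D _ _ u v HD Cb (C1_2d_opp _ _ Ca)
    (cauchy_riemann_conj _ _ _ CR) Huv) as [B HB].
  now exists A, B. }
destruct (K q0) as (A0 & B0 & [HA0 HA0'] & [HB0 HB0']); [unfold coordinate; tauto|].
destruct (K q1) as (A1 & B1 & [HA1 HA1'] & [HB1 HB1']); [unfold coordinate; tauto|].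
destruct (K q2) as (A2 & B2 & [HA2 HA2'] & [HB2 HB2']); [unfold coordinate; tauto|].
destruct (K q3) as (A3 & B3 & [HA3 HA3'] & [HB3 HB3']); [unfold coordinate; tauto|].
exists (mkq A0 A1 A2 A3), (mkq B0 B1 B2 B3).
split; [|split; [|split]]; (split; [|split; [|split]]); assumption.
Qed.

(** * Slice functions and their second partial derivatives *)

Lemma sphere_sqr I : sphere I -> q0 I = 0 /\ q1 I ^ 2 + q2 I ^ 2 + q3 I ^ 2 = 1.
Proof.
intros [H0 H1]; split; [exact H0|]; unfold qnorm in H1; rewrite H0 in H1.
rewrite <- sqrt_1 in H1; apply sqrt_inj in H1; [nra| |lra].
assert (0 <= q1 I ^ 2) by apply pow2_ge_0.
assert (0 <= q2 I ^ 2) by apply pow2_ge_0.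
assert (0 <= q3 I ^ 2) by apply pow2_ge_0.
lra.
Qed.

Lemma sphere_of_sqr I :
  q0 I = 0 -> q1 I ^ 2 + q2 I ^ 2 + q3 I ^ 2 = 1 -> sphere I.
Proof.
intros H0 H1; split; [exact H0|]; unfold qnorm; rewrite H0.
rewrite <- sqrt_1; f_equal; rewrite <- H1; ring.
Qed.

Lemma sphere_opp I : sphere I -> sphere (- I)%quat.
Proof.
intros HI; destruct (sphere_sqr I HI) as [H0 H1]; apply sphere_of_sqr; qunfold; lra.
Qed.

Lemma sphere_units : sphere e1 /\ sphere e2 /\ sphere e3.
Proof. split; [|split]; apply sphere_of_sqr; qunfold; ring. Qed.

Lemma qvec_sqr p : qnorm (qvec p) ^ 2 = q1 p ^ 2 + q2 p ^ 2 + q3 p ^ 2.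
Proof.
unfold qnorm; rewrite pow2_sqrt.
- qunfold; ring.
- assert (0 <= q1 p ^ 2) by apply pow2_ge_0.
  assert (0 <= q2 p ^ 2) by apply pow2_ge_0.
  assert (0 <= q3 p ^ 2) by apply pow2_ge_0.
  qunfold; lra.
Qed.

Lemma qvec_norm_eq p v :
  0 <= v -> v ^ 2 = q1 p ^ 2 + q2 p ^ 2 + q3 p ^ 2 -> qnorm (qvec p) = v.
Proof.
intros Hv Hp; rewrite <- (sqrt_pow2 v Hv), Hp; unfold qnorm; f_equal; qunfold; ring.
Qed.

Lemma qvec_norm_pos p : ~ is_real p -> 0 < qnorm (qvec p).
Proof.
intros Hp; destruct (Rle_lt_or_eq_dec 0 (qnorm (qvec p))) as [H|H];
  [apply sqrt_pos|exact H|exfalso].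
apply Hp; assert (E := qvec_sqr p); rewrite <- H in E.
assert (P1 := pow2_ge_0 (q1 p)); assert (P2 := pow2_ge_0 (q2 p)).
assert (P3 := pow2_ge_0 (q3 p)).
assert (Z : forall x, x ^ 2 = 0 -> x = 0) by (intros; nra).
apply quat_ext; [reflexivity|change (q1 p = 0)|change (q2 p = 0)|change (q3 p = 0)];
  apply Z; lra.
Qed.

Lemma Iunit_sphere p : ~ is_real p -> sphere (Iunit p).
Proof.
intros Hp; assert (Hv := qvec_norm_pos p Hp); assert (E := qvec_sqr p).
unfold Iunit; set (v := qnorm (qvec p)) in *.
apply sphere_of_sqr; [qunfold; ring|].
transitivity (/ v ^ 2 * (q1 p ^ 2 + q2 p ^ 2 + q3 p ^ 2)).
- qunfold; field; lra.
- rewrite <- E; field; lra.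
Qed.

Lemma Iunit_polar p :
  ~ is_real p -> (RtoQ (q0 p) + Iunit p * RtoQ (qnorm (qvec p)))%quat = p.
Proof.
intros Hp; assert (Hv := qvec_norm_pos p Hp).
unfold Iunit; set (v := qnorm (qvec p)) in *.
apply quat_ext; qunfold; field; lra.
Qed.

Lemma slice_domain_intro U p u v :
  axially_symmetric U -> U p -> q0 p = u ->
  v ^ 2 = q1 p ^ 2 + q2 p ^ 2 + q3 p ^ 2 -> slice_domain U u v.
Proof.
intros Hax Hp <- Hv I HI; apply (Hax p Hp).
destruct (Rle_dec 0 v) as [H|H].
- exists I; split; [exact HI|]; now rewrite (qvec_norm_eq p v).
(* [qclass] uses a nonnegative radius; for negative [v] the sign is moved into the unit. *)
- exists (- I)%quat; split; [now apply sphere_opp|].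
  rewrite (qvec_norm_eq p (- v)); [qring|lra|rewrite <- Hv; ring].
Qed.

(** Openness is checked on the single slice of [e1]; axial symmetry then spreads each nearby point
    over its whole sphere. *)
Lemma slice_domain_open U :
  open U -> axially_symmetric U -> open_2d (slice_domain U).
Proof.
intros Ho Hax u v Huv.
assert (H := Huv e1 (proj1 sphere_units)).
destruct (Ho _ H) as [d Hd]; exists d; intros u' v' Hu Hv.
apply (slice_domain_intro U (mkq u' v' 0 0)); [exact Hax| |reflexivity|qunfold; ring].
apply Hd; clear - Hu Hv.
assert (H0 : forall x : R, ball x d x) by (intros; apply ball_center).
repeat split; qunfold.
- replace (u + (0 * v - 1 * 0 - 0 * 0 - 0 * 0)) with u by ring; exact Hu.
- replace (0 + (0 * 0 + 1 * v + 0 * 0 - 0 * 0)) with v by ring; exact Hv.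
- replace (0 + (0 * 0 - 1 * 0 + 0 * v + 0 * 0)) with 0 by ring; apply H0.
- replace (0 + (0 * 0 + 1 * 0 - 0 * 0 + 0 * v)) with 0 by ring; apply H0.
Qed.

(** The content of [slice_hyperholomorphic] for a fixed choice of the two components, so that
    several lemmas can share them. *)
Definition slice_rep (U : quat -> Prop) (f : quat -> quat) (alpha beta : R -> R -> quat) :=
  C1_on (slice_domain U) alpha /\ C1_on (slice_domain U) beta /\
  forall u v, slice_domain U u v ->
    (forall I, sphere I ->
       f (RtoQ u + I * RtoQ v)%quat = (alpha u v + I * beta u v)%quat) /\
    alpha u v = alpha u (- v)%R /\
    beta u v = (- beta u (- v)%R)%quat /\
    (du alpha u v - dv beta u v)%quat = RtoQ 0 /\
    (dv alpha u v + du beta u v)%quat = RtoQ 0.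

Lemma slice_rep_second U f alpha beta u v :
  open U -> axially_symmetric U -> slice_rep U f alpha beta -> slice_domain U u v ->
  exists A B,
    is_qderive (fun x => du alpha x v) u A /\
    is_qderive (fun y => dv alpha u y) v (- A)%quat /\
    is_qderive (fun x => du beta x v) u B /\
    is_qderive (fun y => dv beta u y) v (- B)%quat.
Proof.
intros Ho Hax (Ha & Hb & H) Huv.
apply (slice_pair_second (slice_domain U)); auto using slice_domain_open.
intros x y Hxy; apply (H x y Hxy).
Qed.

Lemma C1_on_du D a u v : C1_on D a -> D u v -> is_qderive (fun x => a x v) u (du a u v).
Proof. intros Ha Huv; apply ex_is_qderive, (Ha u v Huv). Qed.
Lemma C1_on_dv D a u v : C1_on D a -> D u v -> is_qderive (fun y => a u y) v (dv a u v).
Proof. intros Ha Huv; apply ex_is_qderive, (Ha u v Huv). Qed.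

(** * Second derivatives along the coordinate directions *)

(** Along the real direction [I] and [v] stay fixed and only [u] moves. The case [v = 0] is
    included, with any unit [I]. *)
Lemma partial2_scalar U f alpha beta I u v A B :
  open U -> axially_symmetric U -> slice_rep U f alpha beta ->
  slice_domain U u v -> sphere I ->
  is_qderive (fun x => du alpha x v) u A ->
  is_qderive (fun x => du beta x v) u B ->
  is_partial2 (RtoQ 1) f (RtoQ u + I * RtoQ v)%quat
    (du alpha u v + I * du beta u v)%quat (A + I * B)%quat.
Proof.
intros Ho Hax (Ha & Hb & H) Huv HI HA HB.
assert (HD : locally 0 (fun t => slice_domain U (u + t) v)).
{ destruct (slice_domain_open U Ho Hax u v Huv) as [d Hd]; exists d; intros t Ht.
  apply Hd; [|rewrite Rminus_diag, Rabs_R0; apply cond_pos].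
  replace (u + t - u) with (t - 0) by ring; exact Ht. }
set (g' := fun t : R => (du alpha (u + t)%R v + I * du beta (u + t)%R v)%quat).
replace (du alpha u v + I * du beta u v)%quat with (g' 0)
  by (unfold g'; now rewrite Rplus_0_r).
assert (Hs : forall t, is_derive (fun t => u + t) t 1)
  by (intros t; auto_derive; [easy|ring]).
apply (is_partial2_of_line _ _ _
  (fun t : R => (alpha (u + t)%R v + I * beta (u + t)%R v)%quat)).
- generalize HD; apply filter_imp; intros t Ht.
  rewrite <- (proj1 (H _ _ Ht) I HI); f_equal; qring.
- generalize HD; apply filter_imp; intros t Ht; unfold g'.
  eapply is_qderive_eq.
  + apply is_qderive_add.
    * apply (is_qderive_comp (fun x => alpha x v)); [|apply Hs].
      now apply (C1_on_du (slice_domain U)).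
    * apply is_qderive_mul; [apply is_qderive_const|].
      apply (is_qderive_comp (fun x => beta x v)); [|apply Hs].
      now apply (C1_on_du (slice_domain U)).
  + qring.
- unfold g'; eapply is_qderive_eq.
  + apply is_qderive_add.
    * apply (is_qderive_comp (fun x => du alpha x v)); [|apply Hs].
      rewrite Rplus_0_r; exact HA.
    * apply is_qderive_mul; [apply is_qderive_const|].
      apply (is_qderive_comp (fun x => du beta x v)); [|apply Hs].
      rewrite Rplus_0_r; exact HB.
  + qring.
Qed.

(** The line through [u] along [e] stays in one slice. A signed parameter [t] replaces the radius,
    which avoids its singularity at 0. *)
Lemma partial2_imaginary_at_real U f alpha beta e u A B :
  open U -> axially_symmetric U -> slice_rep U f alpha beta ->
  slice_domain U u 0 -> sphere e ->
  is_qderive (fun y => dv alpha u y) 0 A ->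
  is_qderive (fun y => dv beta u y) 0 B ->
  is_partial2 e f (RtoQ u) (dv alpha u 0 + e * dv beta u 0)%quat (A + e * B)%quat.
Proof.
intros Ho Hax (Ha & Hb & H) Huv He HA HB.
assert (HD : locally 0 (fun t => slice_domain U u t)).
{ destruct (slice_domain_open U Ho Hax u 0 Huv) as [d Hd]; exists d; intros t Ht.
  apply Hd; [rewrite Rminus_diag, Rabs_R0; apply cond_pos|exact Ht]. }
apply (is_partial2_of_line _ _ _ (fun t : R => (alpha u t + e * beta u t)%quat)
  (fun t : R => (dv alpha u t + e * dv beta u t)%quat)).
- generalize HD; apply filter_imp; intros t Ht.
  rewrite <- (proj1 (H _ _ Ht) e He); f_equal; qring.
- generalize HD; apply filter_imp; intros t Ht.
  eapply is_qderive_eq.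
  + apply is_qderive_add; [now apply (C1_on_dv (slice_domain U))|].
    apply is_qderive_mul; [apply is_qderive_const|].
    now apply (C1_on_dv (slice_domain U)).
  + qring.
- eapply is_qderive_eq.
  + apply is_qderive_add; [exact HA|].
    apply is_qderive_mul; [apply is_qderive_const|exact HB].
  + qring.
Qed.

(** With s = |w|^2 and c the inner product of [w] with a unit vector [e], the function [v] is |w + t
    e|. *)
Lemma radius_derivatives (s c : R) :
  0 < s ->
  let v := fun t : R => sqrt (s + 2 * c * t + t ^ 2) in
  let v' := fun t => (c + t) / v t in
  locally 0 (fun t => 0 < v t) /\ locally 0 (fun t => is_derive v t (v' t)) /\
  is_derive v' 0 ((1 - (c / v 0) ^ 2) / v 0).
Proof.
intros Hs v v'.
assert (HN : locally 0 (fun t : R => 0 < s + 2 * c * t + t ^ 2)).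
{ assert (C : continuous (fun t : R => s + 2 * c * t + t ^ 2) 0)
    by (apply (ex_derive_continuous (V := R_NormedModule)); auto_derive; easy).
  apply C, (open_gt 0); lra. }
assert (Hv : forall t, 0 < s + 2 * c * t + t ^ 2 -> is_derive v t (v' t)).
{ intros t Ht; unfold v', v; assert (Hq := sqrt_lt_R0 _ Ht).
  auto_derive; [simpl in Ht; lra|].
  simpl in *; field; lra. }
assert (H0 : 0 < v 0) by (apply sqrt_lt_R0; lra).
split; [|split].
- generalize HN; apply filter_imp; intros t Ht; now apply sqrt_lt_R0.
- generalize HN; apply filter_imp; exact Hv.
- eapply is_derive_Req.
  + apply is_derive_div; [|apply Hv; lra|lra].
    apply is_derive_Rplus; [apply is_derive_Rconst|apply (is_derive_id (K := R_AbsRing))].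
  + unfold v', one; simpl; field; lra.
Qed.

Lemma is_derive_inv_pos (v : R -> R) t v1 :
  is_derive v t v1 -> 0 < v t -> is_derive (fun s => / v s) t (- v1 / v t ^ 2).
Proof. intros H Hv; apply is_derive_inv; [exact H|lra]. Qed.

Lemma is_qderive_line (w e : quat) t :
  is_qderive (fun t => w + RtoQ t * e)%quat t e.
Proof.
eapply is_qderive_eq.
- apply is_qderive_add; [apply is_qderive_const|].
  apply is_qderive_mul; [|apply is_qderive_const].
  apply is_qderive_RtoQ, (is_derive_id (K := R_AbsRing)).
- unfold one; simpl; qring.
Qed.

(** On the line, f = alpha(u, V) + W G with V = |W|, W = w + t e and G = beta(u, V) / V. Since W is
    affine, the second derivative is that of alpha(u, V) plus 2 e G' + W G''. At 0 one has V' = x,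
    the cosine of the angle between [w] and [e], and V'' = (1 - x^2) / v, which gives the
    coefficients. *)
Lemma partial2_imaginary U f alpha beta e p A B :
  open U -> axially_symmetric U -> slice_rep U f alpha beta ->
  U p -> ~ is_real p -> sphere e ->
  let u := q0 p in
  let v := qnorm (qvec p) in
  let x := (q1 p * q1 e + q2 p * q2 e + q3 p * q3 e) / v in
  let k := / v in
  is_qderive (fun y => dv alpha u y) v A ->
  is_qderive (fun y => dv beta u y) v B ->
  exists d, is_partial2 e f p d
    (RtoQ ((1 - x ^ 2) * k) * dv alpha u v + RtoQ (x ^ 2) * A
     + RtoQ 2 * (e * (RtoQ (- x * k ^ 2) * beta u v + RtoQ (k * x) * dv beta u v))
     + qvec p * (RtoQ ((3 * x ^ 2 - 1) * k ^ 3) * beta u v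
                 + RtoQ ((1 - 3 * x ^ 2) * k ^ 2) * dv beta u v
                 + RtoQ (k * x ^ 2) * B))%quat.
Proof.
intros Ho Hax (Ha & Hb & H) Hp Hr He u v x k HA HB.
destruct (sphere_sqr e He) as [He0 He1].
assert (Hv := qvec_norm_pos p Hr); fold v in Hv.
assert (Hv2 := qvec_sqr p); fold v in Hv2.
set (c := q1 p * q1 e + q2 p * q2 e + q3 p * q3 e).
destruct (radius_derivatives (v ^ 2) c ltac:(nra)) as (V0 & V1 & V2).
set (V := fun t : R => sqrt (v ^ 2 + 2 * c * t + t ^ 2)).
set (V' := fun t => (c + t) / V t).
change (locally 0 (fun t => 0 < V t)) in V0.
change (locally 0 (fun t => is_derive V t (V' t))) in V1.
change (is_derive V' 0 ((1 - (c / V 0) ^ 2) / V 0)) in V2.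
assert (EV : V 0 = v).
{ unfold V; rewrite <- (sqrt_pow2 v) at 2 by lra; f_equal; ring. }
assert (EV' : V' 0 = x) by (unfold V'; rewrite EV; unfold x, c; f_equal; ring).
assert (Eq : forall t, q0 (p + RtoQ t * e)%quat = u).
{ intros t; unfold u; qunfold; rewrite He0; ring. }
assert (En : forall t, qnorm (qvec (p + RtoQ t * e)%quat) = V t).
{ intros t; unfold qnorm, V; f_equal; rewrite Hv2; unfold c.
  transitivity (q1 p ^ 2 + q2 p ^ 2 + q3 p ^ 2 + 2 * c * t
    + t ^ 2 * (q1 e ^ 2 + q2 e ^ 2 + q3 e ^ 2)).
  - unfold c; qunfold; rewrite He0; ring.
  - rewrite He1; unfold c; ring. }
assert (Huv : slice_domain U u v) by (apply (slice_domain_intro U p); auto).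
assert (HD : locally 0 (fun t => slice_domain U u (V t))).
{ assert (L := locally_2d_1d_const_x _ _ _ (slice_domain_open U Ho Hax u v Huv)).
  assert (C : continuous V 0).
  { apply (ex_derive_continuous (V := R_NormedModule)); exists (V' 0).
    apply (locally_singleton _ _ V1). }
  apply C; rewrite EV; exact L. }
set (W := fun t : R => (qvec p + RtoQ t * e)%quat).
(* The derivative of 1/V, named because it is differentiated once more below. *)
set (K := fun t : R => - V' t / V t ^ 2).
set (G := fun t => (RtoQ (/ V t) * beta u (V t))%quat).
set (G' := fun t => (RtoQ (K t) * beta u (V t)
  + RtoQ (/ V t) * (RtoQ (V' t) * dv beta u (V t)))%quat).
assert (HG : locally 0 (fun t => is_qderive G t (G' t))).
{ generalize (filter_and _ _ HD (filter_and _ _ V0 V1)); apply filter_imp.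
  intros t (Dt & Pt & Vt); 
  apply (is_qderive_mul (fun t => RtoQ (/ V t)) (fun t => beta u (V t))).
  - now apply (is_qderive_RtoQ (fun t => / V t)), is_derive_inv_pos.
  - apply (is_qderive_comp (fun y => beta u y)); [|exact Vt].
    now apply (C1_on_dv (slice_domain U)). }
exists (RtoQ (V' 0) * dv alpha u (V 0) + (e * G 0 + W 0 * G' 0))%quat.
apply (is_partial2_of_line _ _ _ (fun t => alpha u (V t) + W t * G t)%quat
  (fun t => RtoQ (V' t) * dv alpha u (V t) + (e * G t + W t * G' t))%quat).
- generalize (filter_and _ _ HD V0); apply filter_imp; intros t [Dt Pt].
  (* Positivity of the radius keeps the moving point off the real axis, so its polar form is
     available. *)
  assert (Hnr : ~ is_real (p + RtoQ t * e)%quat).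
  { intros Hre; rewrite <- En, Hre in Pt; revert Pt; unfold qnorm.
    replace (q0 (RtoQ 0) ^ 2 + _ + _ + _) with 0 by (qunfold; ring).
    rewrite sqrt_0; lra. }
  rewrite <- (Iunit_polar _ Hnr), Eq, En.
  rewrite (proj1 (H _ _ Dt) _ (Iunit_sphere _ Hnr)).
  unfold Iunit, W, G; rewrite En.
  replace (qvec (p + RtoQ t * e)%quat) with (qvec p + RtoQ t * e)%quat
    by (apply quat_ext; qunfold; rewrite ?He0; ring).
  f_equal; set (Wt := (qvec p + RtoQ t * e)%quat); qring.
- generalize (filter_and _ _ HG (filter_and _ _ HD V1)); apply filter_imp.
  intros t (Gt & Dt & Vt); apply is_qderive_add.
  + apply (is_qderive_comp (fun y => alpha u y)); [|exact Vt].
    now apply (C1_on_dv (slice_domain U)).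
  + apply is_qderive_mul; [apply is_qderive_line|exact Gt].
- assert (P0 := locally_singleton _ _ V0); assert (D0 := locally_singleton _ _ V1).
  assert (G0 := locally_singleton _ _ HG).
  assert (HK : is_derive K 0 ((3 * x ^ 2 - 1) * k ^ 3)).
  { eapply is_derive_Req.
    - unfold K; apply is_derive_div.
      + apply (is_derive_opp (K := R_AbsRing) (V := R_NormedModule)); exact V2.
      + apply (is_derive_pow V 2); exact D0.
      + apply pow_nonzero; lra.
    - unfold opp; simpl; unfold k; rewrite EV', EV.
      fold c; replace (c / v) with x by reflexivity; field; lra. }
  assert (HA0 : is_qderive (fun t => dv alpha u (V t)) 0 (RtoQ (V' 0) * A)%quat).
  { apply (is_qderive_comp (fun y => dv alpha u y)); [rewrite EV; exact HA|exact D0]. }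
  assert (HB0 : is_qderive (fun t => dv beta u (V t)) 0 (RtoQ (V' 0) * B)%quat).
  { apply (is_qderive_comp (fun y => dv beta u y)); [rewrite EV; exact HB|exact D0]. }
  assert (Hb0 : is_qderive (fun t => beta u (V t)) 0 (RtoQ (V' 0) * dv beta u (V 0))%quat).
  { apply (is_qderive_comp (fun y => beta u y)); [|exact D0].
    rewrite EV; now apply (C1_on_dv (slice_domain U)). }
  eapply is_qderive_eq.
  + apply is_qderive_add.
    * apply is_qderive_mul; [apply is_qderive_RtoQ, V2|exact HA0].
    * apply is_qderive_add.
      -- apply is_qderive_mul; [apply is_qderive_const|exact G0].
      -- apply is_qderive_mul; [apply is_qderive_line|].
         apply is_qderive_add.
         ++ apply is_qderive_mul; [apply is_qderive_RtoQ, HK|exact Hb0].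
         ++ apply is_qderive_mul.
            ** apply is_qderive_RtoQ, is_derive_inv_pos; [exact D0|exact P0].
            ** apply is_qderive_mul; [apply is_qderive_RtoQ, V2|exact HB0].
  + unfold G', G, W, K; rewrite EV', EV; fold k.
    replace (c / v) with x by reflexivity.
    replace (- x / v ^ 2) with (- x * k ^ 2) by (unfold k; field; lra).
    replace ((1 - x ^ 2) / v) with ((1 - x ^ 2) * k) by reflexivity.
    clearbody x k; clear.
    generalize (dv alpha u v) (dv beta u v) (beta u v) (qvec p); intros a b b0 w.
    qring.
Qed.

(** * The Laplacian of a slice function on and off the real axis *)

Lemma is_real_eq p : is_real p -> p = RtoQ (q0 p).
Proof.
intros H; apply quat_ext; [reflexivity| | |].
- exact (f_equal q1 H).
- exact (f_equal q2 H).
- exact (f_equal q3 H).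
Qed.

Lemma slice_domain_real U u : axially_symmetric U -> U (RtoQ u) -> slice_domain U u 0.
Proof.
intros Hax Hu; apply (slice_domain_intro U (RtoQ u)); auto; qunfold; ring.
Qed.

Lemma slice_domain_polar U p :
  axially_symmetric U -> U p -> slice_domain U (q0 p) (qnorm (qvec p)).
Proof. intros Hax Hp; apply (slice_domain_intro U p); auto using qvec_sqr. Qed.

Lemma slice_partial2_ex U f p e :
  open U -> axially_symmetric U -> slice_hyperholomorphic U f -> U p ->
  e = RtoQ 1 \/ sphere e -> exists d l, is_partial2 e f p d l.
Proof.
intros Ho Hax (alpha & beta & Hf) Hp He.
destruct (classic (is_real p)) as [Hr|Hr].
- rewrite (is_real_eq p Hr) in *; set (u := q0 p) in *.
  assert (Hu := slice_domain_real U u Hax Hp).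
  destruct (slice_rep_second U f alpha beta u 0 Ho Hax Hf Hu)
    as (A & B & HA & HA' & HB & HB').
  destruct He as [->|He].
  (* A real point lies in every slice; [e1] is an arbitrary choice. *)
  + assert (E := partial2_scalar U f alpha beta e1 u 0 A B Ho Hax Hf Hu
      (proj1 sphere_units) HA HB).
    replace (RtoQ u + e1 * RtoQ 0)%quat with (RtoQ u) in E by qring; eauto.
  + do 2 eexists; apply (partial2_imaginary_at_real U f alpha beta e u); eauto.
- assert (Hu := slice_domain_polar U p Hax Hp).
  destruct (slice_rep_second U f alpha beta _ _ Ho Hax Hf Hu)
    as (A & B & HA & HA' & HB & HB').
  destruct He as [->|He].
  + assert (E := partial2_scalar U f alpha beta (Iunit p) _ _ A B Ho Hax Hf Hu
      (Iunit_sphere p Hr) HA HB).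
    rewrite (Iunit_polar p Hr) in E; eauto.
  + destruct (partial2_imaginary U f alpha beta e p _ _ Ho Hax Hf Hp Hr He HA' HB')
      as [d Hd].
    eauto.
Qed.

Lemma slice_ex_laplacian U f p :
  open U -> axially_symmetric U -> slice_hyperholomorphic U f -> U p -> ex_laplacian f p.
Proof.
intros Ho Hax Hf Hp.
assert (K : forall e, e = RtoQ 1 \/ sphere e -> ex_partial2 e f p).
{ intros e He; split.
  - generalize (Ho p Hp); apply filter_imp; intros q Hq.
    destruct (slice_partial2_ex U f q e Ho Hax Hf Hq He) as (d & l & H).
    apply (is_partial2_correct e f q d l H).
  - destruct (slice_partial2_ex U f p e Ho Hax Hf Hp He) as (d & l & H).
    apply (is_partial2_correct e f p d l H). }
destruct sphere_units as (S1 & S2 & S3).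
split; [|split; [|split]]; apply K; auto.
Qed.

(** The real direction contributes [A] and each of the three imaginary ones [- A], once the [B]
    terms are shown to vanish. *)
Lemma slice_laplacian_real U f u :
  open U -> axially_symmetric U -> slice_hyperholomorphic U f -> U (RtoQ u) ->
  laplacian f (RtoQ u)
  = (RtoQ (-2) * partial (RtoQ 1) (partial (RtoQ 1) f) (RtoQ u))%quat.
Proof.
intros Ho Hax (alpha & beta & Hf) Hp.
assert (Hu := slice_domain_real U u Hax Hp).
destruct (slice_rep_second U f alpha beta u 0 Ho Hax Hf Hu)
  as (A & B & HA & HA' & HB & HB').
destruct sphere_units as (S1 & S2 & S3).
(* [beta] is odd in its second argument, hence zero along the real axis near [u], and so are its
   [u]-derivatives there. *)
assert (HB0 : B = RtoQ 0).
{ assert (L := locally_2d_1d_const_y _ _ _ (slice_domain_open U Ho Hax u 0 Hu)).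
  assert (Z : locally u (fun t => beta t 0 = RtoQ 0)).
  { generalize L; apply filter_imp; intros t Ht.
    destruct (proj2 (proj2 Hf) t 0 Ht) as (_ & _ & E & _).
    rewrite Ropp_0 in E; apply quat_ext.
    - apply (f_equal q0) in E; change (q0 (beta t 0) = - q0 (beta t 0)) in E;
        change (q0 (beta t 0) = 0); lra.
    - apply (f_equal q1) in E; change (q1 (beta t 0) = - q1 (beta t 0)) in E;
        change (q1 (beta t 0) = 0); lra.
    - apply (f_equal q2) in E; change (q2 (beta t 0) = - q2 (beta t 0)) in E;
        change (q2 (beta t 0) = 0); lra.
    - apply (f_equal q3) in E; change (q3 (beta t 0) = - q3 (beta t 0)) in E;
        change (q3 (beta t 0) = 0); lra. }
  rewrite <- (is_qderive_unique _ _ _ HB); apply is_qderive_unique.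
  apply is_qderive_ext_loc with (2 := is_qderive_const (RtoQ 0) u).
  apply locally_locally in Z; generalize Z; apply filter_imp; intros t Zt.
  symmetry; apply is_qderive_unique.
  apply is_qderive_ext_loc with (2 := is_qderive_const (RtoQ 0) t).
  generalize Zt; apply filter_imp; now intros s ->. }
assert (P0 : partial (RtoQ 1) (partial (RtoQ 1) f) (RtoQ u) = (A + e1 * B)%quat).
{ assert (E := partial2_scalar U f alpha beta e1 u 0 A B Ho Hax Hf Hu S1 HA HB).
  replace (RtoQ u + e1 * RtoQ 0)%quat with (RtoQ u) in E by qring.
  apply (is_partial2_correct _ _ _ _ _ E). }
assert (P : forall e, sphere e ->
  partial e (partial e f) (RtoQ u) = (- A + e * - B)%quat).
{ intros e He.
  exact (proj2 (proj2 (proj2 (is_partial2_correct _ _ _ _ _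
    (partial2_imaginary_at_real U f alpha beta e u _ _ Ho Hax Hf Hu He HA' HB'))))). }
unfold laplacian; rewrite P0, !P, HB0 by assumption; qring.
Qed.

(** Let x1, x2, x3 be the coordinates of the unit vector [Iunit q]. Summing over the three imaginary
    directions uses only that their squares add up to 1: the coefficients 1 - x^2 sum to 2, the
    coefficients 3 x^2 - 1 cancel, and the terms x e sum to [Iunit q]. The second derivatives [A]
    and [B] then cancel against the real direction. *)
Lemma slice_laplacian_nonreal U f q I :
  open U -> axially_symmetric U -> slice_hyperholomorphic U f ->
  U q -> ~ is_real q -> sphere I ->
  let u := q0 q in
  let v := qnorm (qvec q) in
  laplacian f q =
    (RtoQ (/ v ^ 2) * Iunit q *
      (RtoQ (2 * v) * partial (RtoQ 1) f q
       - I * (f (RtoQ u - I * RtoQ v) - f (RtoQ u + I * RtoQ v))))%quat.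
Proof.
intros Ho Hax (alpha & beta & Hf) Hq Hr HI u v.
assert (Hu := slice_domain_polar U q Hax Hq).
destruct (slice_rep_second U f alpha beta _ _ Ho Hax Hf Hu)
  as (A & B & HA & HA' & HB & HB').
assert (Hv := qvec_norm_pos q Hr); assert (Hv2 := qvec_sqr q).
assert (P0 : is_partial2 (RtoQ 1) f q (du alpha u v + Iunit q * du beta u v)%quat
  (A + Iunit q * B)%quat).
{ assert (E := partial2_scalar U f alpha beta (Iunit q) _ _ A B Ho Hax Hf Hu
    (Iunit_sphere q Hr) HA HB).
  rewrite (Iunit_polar q Hr) in E; exact E. }
destruct sphere_units as (S1 & S2 & S3).
destruct (is_partial2_correct _ _ _ _ _ P0) as (_ & Ed & _ & E0).
destruct (partial2_imaginary U f alpha beta e1 q _ _ Ho Hax Hf Hq Hr S1 HA' HB') as [d1 P1].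
destruct (partial2_imaginary U f alpha beta e2 q _ _ Ho Hax Hf Hq Hr S2 HA' HB') as [d2 P2].
destruct (partial2_imaginary U f alpha beta e3 q _ _ Ho Hax Hf Hq Hr S3 HA' HB') as [d3 P3].
apply is_partial2_correct, proj2, proj2, proj2 in P1, P2, P3.
destruct (proj2 (proj2 Hf) u v Hu) as (F & Ea & Eb & C1 & C2).
assert (Fm : f (RtoQ u - I * RtoQ v)%quat = (alpha u v - I * beta u v)%quat).
{ replace (RtoQ u - I * RtoQ v)%quat with (RtoQ u + - I * RtoQ v)%quat by qring.
  rewrite (F _ (sphere_opp I HI)); qring. }
assert (II : (I * I)%quat = RtoQ (-1)).
{ destruct (sphere_sqr I HI) as [I0 I1].
  apply quat_ext; qcoord; rewrite I0; lra. }
(* The difference is -2 I beta, and I^2 = -1 removes [I]; hence the formula is the same for every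
   [I]. *)
assert (EJ : (I * (f (RtoQ u - I * RtoQ v) - f (RtoQ u + I * RtoQ v)))%quat
  = (RtoQ 2 * beta u v)%quat).
{ rewrite Fm, (F I HI).
  transitivity (RtoQ (-2) * ((I * I) * beta u v))%quat; [qring|rewrite II; qring]. }
(* The Cauchy-Riemann equations express the [u]-derivative of [f] through the [v]-derivatives that
   occur in the Laplacian. *)
assert (Eu1 : du alpha u v = dv beta u v).
{ transitivity (du alpha u v - dv beta u v + dv beta u v)%quat;
    [qring|rewrite C1; qring]. }
assert (Eu2 : du beta u v = (- dv alpha u v)%quat).
{ transitivity (dv alpha u v + du beta u v - dv alpha u v)%quat;
    [qring|rewrite C2; qring]. }
unfold laplacian; rewrite E0, P1, P2, P3, EJ, Ed, Eu1, Eu2.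
fold u v in Hv, Hv2 |- *.
unfold Iunit; fold v.
generalize (dv alpha u v) (dv beta u v) (beta u v); intros a b b0.
set (k := / v).
set (x1 := k * q1 q); set (x2 := k * q2 q); set (x3 := k * q3 q).
assert (Hk : k * v = 1) by (unfold k; field; lra).
(* The unit-length relation, solved for one monomial so that [ring] can use it as a rewriting
   rule. *)
assert (Hx : x1 * x1 = 1 - x2 * x2 - x3 * x3).
{ unfold x1, x2, x3, k; apply (Rmult_eq_reg_l (v ^ 2)); [|nra].
  field_simplify; [|lra|lra]. nra. }
replace (/ v ^ 2) with (k * k) by (unfold k; field; lra).
replace ((q1 q * q1 e1 + q2 q * q2 e1 + q3 q * q3 e1) / v) with x1
  by (unfold x1, k; qcoord; field; lra).
replace ((q1 q * q1 e2 + q2 q * q2 e2 + q3 q * q3 e2) / v) with x2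
  by (unfold x2, k; qcoord; field; lra).
replace ((q1 q * q1 e3 + q2 q * q2 e3 + q3 q * q3 e3) / v) with x3
  by (unfold x3, k; qcoord; field; lra).
replace (RtoQ k * qvec q)%quat with (mkq 0 x1 x2 x3) by (unfold x1, x2, x3; qring).
(* After this both sides are polynomial in [k], [v] and the xi, and agree modulo [k * v = 1] and the
   unit-length relation. *)
replace (qvec q) with (mkq 0 (v * x1) (v * x2) (v * x3))
  by (apply quat_ext; unfold x1, x2, x3, k; qcoord; field; lra).
clearbody k x1 x2 x3; clear - Hk Hx.
apply quat_ext; qcoord; ring [Hk Hx].
Qed.

Theorem theorem4p14 (U : quat -> Prop) (f fbreve : quat -> quat)
  (hUopen : open U) (hUconn : connected U) (hUax : axially_symmetric U)
  (hf : slice_hyperholomorphic U f)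
  (hfbreve : forall q, U q -> fbreve q = laplacian f q) :
  (forall q, U q -> ex_laplacian f q) /\
  (forall q, U q -> ~ is_real q -> forall I, sphere I ->
     let u := q0 q in
     let v := qnorm (qvec q) in
     fbreve q = laplacian f q /\
     laplacian f q =
       (RtoQ (/ v ^ 2) * Iunit q *
         (RtoQ (2 * v) * partial (RtoQ 1) f q
          - I * (f (RtoQ u - I * RtoQ v) - f (RtoQ u + I * RtoQ v))))%quat) /\
  (forall u : R, U (RtoQ u) ->
     laplacian f (RtoQ u)
     = (RtoQ (-2) * partial (RtoQ 1) (partial (RtoQ 1) f) (RtoQ u))%quat) /\
  (forall f1 : quat -> quat, slice_hyperholomorphic U f1 ->
     (forall q, U q -> laplacian f1 q = laplacian f q) ->
     (forall q, U q -> ~ is_real q -> forall I, sphere I ->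
        let u := q0 q in
        let v := qnorm (qvec q) in
        (RtoQ (/ v ^ 2) * Iunit q *
          (RtoQ (2 * v) * partial (RtoQ 1) f1 q
           - I * (f1 (RtoQ u - I * RtoQ v) - f1 (RtoQ u + I * RtoQ v))))%quat
        =
        (RtoQ (/ v ^ 2) * Iunit q *
          (RtoQ (2 * v) * partial (RtoQ 1) f q
           - I * (f (RtoQ u - I * RtoQ v) - f (RtoQ u + I * RtoQ v))))%quat) /\
     (forall u : R, U (RtoQ u) ->
        (RtoQ (-2) * partial (RtoQ 1) (partial (RtoQ 1) f1) (RtoQ u))%quat
        = (RtoQ (-2) * partial (RtoQ 1) (partial (RtoQ 1) f) (RtoQ u))%quat)).
Proof.
split; [|split; [|split]].
- intros q Hq; now apply (slice_ex_laplacian U).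
- intros q Hq Hr I HI u v; split; [now apply hfbreve|].
  now apply (slice_laplacian_nonreal U).
- intros u Hu; now apply (slice_laplacian_real U).
- intros f1 hf1 H1; split.
  + intros q Hq Hr I HI.
    exact (eq_trans (eq_sym (slice_laplacian_nonreal U f1 q I hUopen hUax hf1 Hq Hr HI))
      (eq_trans (H1 q Hq) (slice_laplacian_nonreal U f q I hUopen hUax hf Hq Hr HI))).
  + intros u Hu.
    rewrite <- (slice_laplacian_real U f u), <- (slice_laplacian_real U f1 u); auto.
Qed.
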